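(* For $d,n\in\mathbb{N}$ satisfying $n\le d/2$, with $\alpha=n/d$, we have $$|B_n^d\cap\mathbb{Z}^d|\approx|S_n^d\cap\mathbb{Z}^d|\approx2^n\binom{d}{n}\exp\Big(\frac{n\alpha}{2}+\frac{n\alpha^2}{4}+O(n\alpha^3)\Big).$$ In particular, if $n\lesssim d^{1/2}$ (that is, $n\le A d^{1/2}$ for a fixed constant $A$, the implicit constants in the conclusion then being allowed to depend on $A$), then $$|B_n^d\cap\mathbb{Z}^d|\approx|S_n^d\cap\mathbb{Z}^d|\approx2^n\binom{d}{n}=|S_n^d\cap\{-1,0,1\}^d|.$$
   Context: $\mathbb{N}=\{1,2,\dots\}$. $B_n^d=\{x\in\mathbb{R}^d:|x_1|+\dots+|x_d|\le n\}$ and $S_n^d=\{x\in\mathbb{R}^d:|x_1|+\dots+|x_d|=n\}$; $|A|$ is the cardinality of a finite set $A$. For positive real quantities, $X\lesssim Y$ means $X\le CY$ with a universal constant $C>0$ (independent of $d,n$), and $X\approx Y$ means $X\lesssim Y\lesssim X$. $O(Y)$ denotes a quantity (depending on $d,n$) of absolute value at most $CY$ with $C$ universal. *)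

(* Defs.v *)
From HB Require Import structures.
From mathcomp Require Import all_boot all_order all_algebra finmap.
From mathcomp Require Import all_classical all_reals all_analysis.
Set Implicit Arguments.
Unset Strict Implicit.
Unset Printing Implicit Defensive.
Import Order.TTheory GRing.Theory Num.Theory.
Local Open Scope classical_set_scope.
Local Open Scope ring_scope.

Definition l1norm (R : realType) (d : nat) (x : 'rV[R]_d) : R :=
  \sum_(i < d) `|x 0 i|.

Definition l1ball (R : realType) (d n : nat) : set 'rV[R]_d :=
  [set x | l1norm x <= n%:R].

Definition l1sphere (R : realType) (d n : nat) : set 'rV[R]_d :=
  [set x | l1norm x = n%:R].

Definition Zlattice (R : realType) (d : nat) : set 'rV[R]_d :=
  [set x | forall i, x 0 i \is a Num.int].

Definition sign_vectors (R : realType) (d : nat) : set 'rV[R]_d :=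
  [set x | forall i, x 0 i \in [:: -1; 0; 1]].

Arguments l1ball : clear implicits.
Arguments l1sphere : clear implicits.
Arguments Zlattice : clear implicits.
Arguments sign_vectors : clear implicits.

Lemma l1sphere_sub_ball (R : realType) (d n : nat) :
  l1sphere R d n `<=` l1ball R d n.
Proof. by move=> x; rewrite /l1sphere /l1ball /= => ->. Qed.

Lemma sign_vectors_sub_Zlattice (R : realType) (d : nat) :
  sign_vectors R d `<=` Zlattice R d.
Proof.
move=> x hx i; have := hx i.
by rewrite !inE => /or3P[] /eqP ->; rewrite ?rpredN ?rpred0 ?rpred1.
Qed.

(* [fset_set A] is empty when [A] is infinite, so [setcard] is the cardinality
   only for finite sets; every set measured below is a subset of
   [l1ball R d n `&` Zlattice R d], which is finite. *)
Lemma finite_l1ball_Zlattice (R : realType) (d n : nat) :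
  finite_set (l1ball R d n `&` Zlattice R d).
Proof.
pose f (g : {ffun 'I_d -> 'I_(n + n).+1}) : 'rV[R]_d :=
  \row_i ((g i : nat)%:R - n%:R).
apply: (@sub_finite_set _ _ (f @` setT)); last first.
  exact/finite_image/finite_finset.
move=> x [/= hx hZ].
have hk i : exists k : 'I_(n + n).+1, x 0 i = (k : nat)%:R - n%:R.
  have hi : `|x 0 i| <= n%:R.
    apply: le_trans hx; rewrite /l1norm (bigD1 i) //= lerDl.
    by apply: sumr_ge0 => j _; exact: normr_ge0.
  have hnat : x 0 i + n%:R \is a Num.nat.
    rewrite natrEint rpredD ?hZ ?rpred_nat //=.
    by move: hi; rewrite ler_norml => /andP[h _]; rewrite addrC -lerBlDl sub0r.
  have /natrP[k hk] := hnat.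
  have hlt : (k < (n + n).+1)%N.
    rewrite ltnS -(ler_nat R) -hk natrD lerD2r.
    by move: hi; rewrite ler_norml => /andP[].
  by exists (Ordinal hlt); rewrite /= -hk addrK.
have [g hg] := choice hk.
exists [ffun i => g i] => //.
by apply/rowP => i; rewrite mxE ffunE -hg.
Qed.

Definition setcard (R : realType) (d : nat) (A : set 'rV[R]_d) : nat :=
  #|` fset_set A|.

Definition ball_count (R : realType) (d n : nat) : nat :=
  setcard (l1ball R d n `&` Zlattice R d).

Definition sphere_count (R : realType) (d n : nat) : nat :=
  setcard (l1sphere R d n `&` Zlattice R d).

(* X ≈ Y, resp. X = O(Y), for quantities indexed by (d, n), with one implicit
   constant for all (d, n) in the range P. *)
Definition approx_on (R : realType) (P : nat -> nat -> Prop)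
    (X Y : nat -> nat -> R) : Prop :=
  exists2 C : R, 0 < C &
    forall d n, P d n -> X d n <= C * Y d n /\ Y d n <= C * X d n.

Definition bigO_on (R : realType) (P : nat -> nat -> Prop)
    (X Y : nat -> nat -> R) : Prop :=
  exists2 C : R, 0 < C & forall d n, P d n -> `|X d n| <= C * Y d n.

Definition half_range (d n : nat) : Prop :=
  [/\ (0 < d)%N, (0 < n)%N & (2 * n <= d)%N].

Definition sqrt_range (R : realType) (A : R) (d n : nat) : Prop :=
  half_range d n /\ n%:R <= A * Num.sqrt (d%:R : R).

(* Main.v *)
Require Import Defs.
From HB Require Import structures.
From mathcomp Require Import all_boot all_order all_algebra finmap.
From mathcomp Require Import all_classical all_reals all_analysis.
From mathcomp Require Import zify ring lra.
(* Idea. The numbers s(n) of lattice points on the l1-sphere of radius n in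
   dimension d have generating function F = ((1 + z) / (1 - z))^d, and
   (1 - z^2) F' = 2 d F gives (n + 1) s(n+1) = 2 d s(n) + (n - 1) s(n-1).
   For t(n) = 2^n C(d, n) one has (n + 1) t(n+1) = 2 (d - n) t(n), so with
   a = n / d the ratio s / t is multiplied at each step by about
   (1 + a^2 / 4) / (1 - a) = exp(a + 3 a^2 / 4 + O(a^3 + 1 / d)); the product of
   these factors is exp(n a / 2 + n a^2 / 4 + O(n a^3 + 1)). *)

Set Implicit Arguments.
Unset Strict Implicit.
Unset Printing Implicit Defensive.
Import Order.TTheory GRing.Theory Num.Theory.
Local Open Scope classical_set_scope.
Local Open Scope ring_scope.

(** * Lattice points of a cube as finite functions *)

(* An integer in [-M, M] is encoded by its translate by M, in ['I_(M + M).+1]. *)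
Definition offset_abs (M j : nat) : nat := ((j - M) + (M - j))%N.

Definition offset_row (R : realType) (d M : nat)
    (g : {ffun 'I_d -> 'I_(M + M).+1}) : 'rV[R]_d :=
  \row_i ((g i : nat)%:R - M%:R).

Definition box_count (d M : nat) (Q : pred nat) : nat :=
  #|[set g : {ffun 'I_d -> 'I_(M + M).+1} | Q (\sum_i offset_abs M (g i))%N]%SET|.

(** This is [1 + 2X + ... + 2X^M], the truncation at degree [M] of (1 + z) / (1 - z). *)
Definition abs_poly (M : nat) : {poly int} :=
  \sum_(j < (M + M).+1) 'X^(offset_abs M j).

Lemma norm_offset (R : realType) (M j : nat) :
  `|j%:R - M%:R| = (offset_abs M j)%:R :> R.
Proof.
rewrite /offset_abs natrD; have [jM|/ltnW Mj] := leqP j M.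
- by rewrite ler0_norm ?subr_le0 ?ler_nat// opprB -natrB// (eqP jM) add0r.
- by rewrite ger0_norm ?subr_ge0 ?ler_nat// -natrB// (eqP Mj) addr0.
Qed.

Lemma l1norm_offset_row (R : realType) d M (g : {ffun 'I_d -> 'I_(M + M).+1}) :
  l1norm (offset_row R g) = (\sum_i offset_abs M (g i))%:R.
Proof.
by rewrite /l1norm natr_sum; apply: eq_bigr => i _; rewrite mxE norm_offset.
Qed.

Lemma offset_row_inj (R : realType) d M : injective (@offset_row R d M).
Proof.
move=> g h /rowP gh; apply/ffunP => i; apply/val_inj/eqP.
by have := gh i; rewrite !mxE => /addIr/eqP; rewrite eqr_nat.
Qed.

Lemma offset_row_surj (R : realType) d M (x : 'rV[R]_d) :
  Zlattice R d x -> (forall i, `|x 0 i| <= M%:R) ->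
  exists g : {ffun 'I_d -> 'I_(M + M).+1}, x = offset_row R g.
Proof.
move=> xZ xM.
have /choice[g xg] i : exists k : 'I_(M + M).+1, x 0 i = (k : nat)%:R - M%:R.
  have /andP[lo hi] : - M%:R <= x 0 i <= M%:R by rewrite -ler_norml.
  have /natrP[k xk] : x 0 i + M%:R \is a Num.nat.
    by rewrite natrEint rpredD ?xZ ?rpred_nat //= -(opprK M%:R) subr_ge0.
  have kM : (k < (M + M).+1)%N by rewrite ltnS -(ler_nat R) -xk natrD lerD2r.
  by exists (Ordinal kM); rewrite /= -xk addrK.
by exists [ffun i => g i]; apply/rowP => i; rewrite mxE ffunE -xg.
Qed.

(** The map [offset_row] is injective and reaches every lattice point with entries bounded by [M].
    The choice of [M] is left to each use: the radius for the ball, anything from the radius upwards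
    for a sphere, 1 for sign vectors. *)
Lemma setcard_box (R : realType) d M (Q : pred nat) (A : set 'rV[R]_d) :
  A `<=` Zlattice R d -> (forall x, A x -> forall i, `|x 0 i| <= M%:R) ->
  (forall g, A (@offset_row R d M g) <-> Q (\sum_i offset_abs M (g i))%N) ->
  setcard A = box_count d M Q.
Proof.
move=> AZ AM AQ; rewrite /setcard /box_count.
set B := [set g | _]%SET.
have -> : A = [set` (@offset_row R d M @` B)%fset].
  apply/seteqP; split => [x Ax | x /= /imfsetP[g]].
    have [g xg] := offset_row_surj (AZ _ Ax) (AM _ Ax).
    by apply/imfsetP; exists g => //=; rewrite inE; apply/AQ; rewrite -xg.
  by rewrite /= inE => /AQ Ag ->.
rewrite set_fsetK card_imfset; last exact: offset_row_inj.
by rewrite /= -cardE.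
Qed.

Lemma l1norm_ge_entry (R : realType) d (x : 'rV[R]_d) i : `|x 0 i| <= l1norm x.
Proof. by rewrite /l1norm (bigD1 i)//= lerDl sumr_ge0. Qed.

Lemma ball_count_box (R : realType) d n :
  ball_count R d n = box_count d n (fun m => m <= n)%N.
Proof.
apply: setcard_box => [x [] //|x [xn _] i|g].
- exact: le_trans (l1norm_ge_entry x i) xn.
- split; first by case; rewrite /l1ball /= l1norm_offset_row ler_nat.
  move=> gn; split; first by rewrite /l1ball /= l1norm_offset_row ler_nat.
  by move=> i; rewrite mxE rpredB ?rpred_nat.
Qed.

(** The bound [M] stays free so that several radii can be read off one polynomial. *)
Lemma sphere_count_box (R : realType) d n M : (n <= M)%N ->
  sphere_count R d n = box_count d M (pred1 n).
Proof.
move=> nM; apply: setcard_box => [x [] //|x [/= xn _] i|g].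
- by rewrite (le_trans (l1norm_ge_entry x i))// xn ler_nat.
- split; first by case; rewrite /l1sphere /= l1norm_offset_row => /eqP; rewrite eqr_nat.
  move=> /eqP gn; split; first by rewrite /l1sphere /= l1norm_offset_row gn.
  by move=> i; rewrite mxE rpredB ?rpred_nat.
Qed.

Lemma sign_count_box (R : realType) d n :
  setcard (l1sphere R d n `&` sign_vectors R d) = box_count d 1 (pred1 n).
Proof.
apply: setcard_box => [x [_ /sign_vectors_sub_Zlattice//]|x [/= _ xs] i|g].
- by have := xs i; rewrite !inE => /or3P[] /eqP ->; rewrite ?normrN ?normr0 ?normr1.
- split; first by case; rewrite /l1sphere /= l1norm_offset_row => /eqP; rewrite eqr_nat.
  move=> /eqP gn; split; first by rewrite /l1sphere /= l1norm_offset_row gn.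
  move=> i; rewrite mxE !inE; case: (g i) => [[|[|[|k]]] ?] //=.
  + by rewrite sub0r eqxx.
  + by rewrite subrr eqxx orbT.
  + by rewrite -natrB// eqxx !orbT.
Qed.

(** * Counts as coefficients of powers of a polynomial *)

(** Expanding the power by distributivity gives one monomial per function [g], of degree the
    l1-weight of [g]. *)
Lemma box_count_coef d M n :
  (box_count d M (pred1 n))%:R = (abs_poly M ^+ d)`_n.
Proof.
rewrite -[in RHS](card_ord d) -prodr_const bigA_distr_bigA coef_sum.
rewrite /box_count -sum1_card natr_sum big_mkcond /=.
apply: eq_bigr => g _.
rewrite (_ : \prod_i _ = 'X^(\sum_i offset_abs M (g i))%N); last first.
  by rewrite -(big_morph _ (exprD 'X) (expr0 'X)).
by rewrite coefXn inE eq_sym /= eq_sym; case: eqP.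
Qed.

Lemma ball_count_sum (R : realType) d n :
  ball_count R d n = (\sum_(m < n.+1) sphere_count R d m)%N.
Proof.
rewrite ball_count_box.
under eq_bigr => m _ do rewrite (sphere_count_box R d (leq_ord m)).
rewrite /box_count -sum1_card; under [RHS]eq_bigr => m _ do rewrite -sum1_card.
rewrite (exchange_big_dep (fun g => g \in [set g : {ffun 'I_d -> 'I_(n + n).+1} | \sum_i offset_abs n (g i) <= n]%N%SET)) /=; last first.
  by move=> m g _; rewrite !inE => /eqP ->; exact: leq_ord.
apply: eq_bigr => g; rewrite inE => gn.
rewrite (big_pred1 (inord (\sum_i offset_abs n (g i)))) // => m.
by rewrite inE [RHS]/= -(inj_eq val_inj) /= inordK// eq_sym.
Qed.

Lemma abs_poly0 : abs_poly 0 = 1.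
Proof. by rewrite /abs_poly big_ord1. Qed.

Lemma abs_polyS M : abs_poly M.+1 = abs_poly M + 'X^(M.+1) *+ 2.
Proof.
have bumpE j : offset_abs M.+1 (bump 0 j) = offset_abs M j.
  by rewrite /offset_abs /bump /= add1n !subSS.
rewrite /abs_poly addnS addSn big_ord_recl big_ord_recr /= bumpE.
under eq_bigr => j _ do rewrite bumpE.
have -> : offset_abs M.+1 0 = M.+1 by [].
have -> : offset_abs M (M + M).+1 = M.+1 by rewrite /offset_abs; lia.
by rewrite mulr2n addrCA.
Qed.

(** Truncated form of (1 - z) F = 1 + z for F = (1 + z) / (1 - z); the correction starts at degree
    [M.+1], out of sight of the coefficients up to [M]. *)
Lemma mul_abs_poly M : (1 - 'X) * abs_poly M = 1 + 'X - 'X^(M.+1) *+ 2.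
Proof.
elim: M => [|M IH]; first by rewrite abs_poly0; ring.
by rewrite abs_polyS mulrDr IH; rewrite !exprS; ring.
Qed.

(** * Initial values and recurrences of the sphere counts *)

Lemma sphere_count_coef (R : realType) d n M : (n <= M)%N ->
  (sphere_count R d n)%:R = (abs_poly M ^+ d)`_n.
Proof. by move=> nM; rewrite (sphere_count_box R d nM) box_count_coef. Qed.

Lemma sphere_count_dim0 (R : realType) n : sphere_count R 0 n = (n == 0%N).
Proof.
apply/eqP; rewrite -(eqr_nat int) (sphere_count_coef R 0 (leqnn n)).
by rewrite expr0 coef1.
Qed.

(* Coefficient extraction in (1 - X) P^(d+1) = (1 + X) P^d - 2 X^(n+2) P^d,
   where P = abs_poly n.+1. *)
Lemma sphere_count_Pascal (R : realType) d n :
  sphere_count R d.+1 n.+1 =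
  (sphere_count R d.+1 n + sphere_count R d n.+1 + sphere_count R d n)%N.
Proof.
apply/eqP; rewrite -(eqr_nat int) !natrD.
rewrite !(@sphere_count_coef R _ n.+1 n.+1)// !(@sphere_count_coef R _ n n.+1)//.
have /(congr1 (fun p : {poly int} => p`_n.+1)) :
  abs_poly n.+1 ^+ d.+1 - 'X * abs_poly n.+1 ^+ d.+1 =
  abs_poly n.+1 ^+ d + 'X * abs_poly n.+1 ^+ d
  - 'X^(n.+2) * (abs_poly n.+1 ^+ d *+ 2).
  rewrite -[X in X - _]mul1r -mulrBl exprS mulrA mul_abs_poly.
  by rewrite mulrBl mulrDl mul1r mulrnAl mulrnAr.
by rewrite !coefB !coefD !coefXM coefXnM ltnSn /= subr0 => /(canRL (subrK _)) ->; apply/eqP; ring.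
Qed.

Lemma sphere_count0 (R : realType) d : sphere_count R d 0 = 1%N.
Proof.
apply/eqP; rewrite -(eqr_nat int) (sphere_count_coef R d (leqnn 0)).
by rewrite abs_poly0 expr1n coef1.
Qed.

Lemma sphere_count1 (R : realType) d : sphere_count R d 1 = (2 * d)%N.
Proof.
elim: d => [|d IH]; first by rewrite sphere_count_dim0.
by rewrite sphere_count_Pascal !sphere_count0 IH; lia.
Qed.

(* Coefficient extraction in (1 - z^2) F' = 2 d F, where
   F = ((1 + z) / (1 - z))^d generates the sphere counts; proved from Pascal's
   rule, since (1 - z^2) F_d' - 2 d F_d obeys it too. *)
Lemma sphere_count_rec (R : realType) d n :
  (n.+2 * sphere_count R d n.+2 =
   2 * d * sphere_count R d n.+1 + n * sphere_count R d n)%N.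
Proof.
elim: d n => [|d IHd] n.
  by rewrite !sphere_count_dim0; case: n => [|n]; rewrite ?muln0.
elim: n => [|n IHn].
  have := IHd 0%N; rewrite !sphere_count_Pascal !sphere_count0 !sphere_count1.
  by nia.
have := IHd n.+1; have := IHd n; move: IHn.
rewrite (sphere_count_Pascal _ _ n.+2) (sphere_count_Pascal _ _ n.+1).
rewrite (sphere_count_Pascal _ _ n).
by nia.
Qed.

(** For [M = 1] the polynomial is 1 + 2X, so the binomial theorem gives the coefficient; for [d < n]
    both sides vanish. *)
Lemma sign_countE (R : realType) d n :
  setcard (l1sphere R d n `&` sign_vectors R d) = (2 ^ n * 'C(d, n))%N.
Proof.
apply/eqP; rewrite sign_count_box -(eqr_nat int) box_count_coef.
rewrite abs_polyS abs_poly0 expr1 exprDn coef_sum.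
under eq_bigr => i _ do
  rewrite expr1n mul1r exprMn_n !coefMn coefXn -mulrnA.
have [nd|dn] := leqP n d; last first.
  rewrite bin_small// muln0 big1// => i _.
  by rewrite (gtn_eqF (leq_trans (ltn_ord i) dn)) mulr0n mul0rn.
rewrite (bigD1 (inord n))//= inordK// eqxx big1 ?addr0// => i.
by rewrite -(inj_eq val_inj) /= inordK// eq_sym => /negPf ->; rewrite mulr0n mul0rn.
Qed.

(** * Exponential bounds for 1 / (1 - x) and 1 + x *)

(** One derivative serves both bounds on 1 / (1 - x): the factor [3 * c * (1 - x) - 1] is
    nonnegative on [0, 1/2] for [c = 1] and equals -1 for [c = 0]. *)
Lemma is_derive_1B_expR_cubic (R : realType) (c x : R) :
  is_derive x 1 (fun x => (1 - x) * expR (x + x ^+ 2 / 2 + c * x ^+ 3))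
    (x ^+ 2 * (3 * c * (1 - x) - 1) * expR (x + x ^+ 2 / 2 + c * x ^+ 3)).
Proof.
apply: is_derive_eq.
by rewrite /GRing.scale /= !mulr1; field.
Qed.

Lemma inv1B_le_expR (R : realType) (a : R) : 0 <= a -> 2 * a <= 1 ->
  1 <= (1 - a) * expR (a + a ^+ 2 / 2 + a ^+ 3).
Proof.
move=> a0 a1; pose f x : R := (1 - x) * expR (x + x ^+ 2 / 2 + 1 * x ^+ 3).
have df := @is_derive_1B_expR_cubic R 1.
suff : f 0 <= f a by rewrite /f !(expr0n, mul1r, mul0r, subr0, addr0) expR0.
apply: (@ger0_derive1_ndecr R f 0 (1 / 2)) => //; last by lra.
- move=> x; rewrite in_itv /= => /andP[x0 x1].
  rewrite derive1E (@derive_val _ _ _ _ _ _ _ (df x)) !mulr_ge0 ?expR_ge0 ?sqr_ge0//; lra.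
- apply: derivable_within_continuous => x _; exact: (@ex_derive _ _ _ _ _ _ _ (df x)).
Qed.

Lemma expR_le_inv1B (R : realType) (a : R) : 0 <= a -> a <= 1 ->
  (1 - a) * expR (a + a ^+ 2 / 2) <= 1.
Proof.
move=> a0 a1; pose f x : R := (1 - x) * expR (x + x ^+ 2 / 2 + 0 * x ^+ 3).
have df := @is_derive_1B_expR_cubic R 0.
suff : f a <= f 0 by rewrite /f !(expr0n, mul1r, mul0r, subr0, addr0) expR0.
apply: (@ler0_derive1_nincr R f 0 1) => //.
- move=> x; rewrite in_itv /= => /andP[x0 x1].
  rewrite derive1E (@derive_val _ _ _ _ _ _ _ (df x)) mulr_le0_ge0 ?expR_ge0//.
  by rewrite mulr_ge0_le0 ?sqr_ge0//; lra.
- apply: derivable_within_continuous => x _; exact: (@ex_derive _ _ _ _ _ _ _ (df x)).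
Qed.

(** Multiply exp(-y) >= 1 - y by 1 + x: the second hypothesis amounts to (1 + x) (1 - y) >= 1. *)
Lemma expR_le1D (R : realType) (x y : R) :
  0 <= x -> y * (1 + x) <= x -> expR y <= 1 + x.
Proof.
move=> x0 yx; have /ler_pM2r <- : 0 < expR (- y) by exact: expR_gt0.
rewrite -expRD subrr expR0.
apply: le_trans (_ : (1 + x) * (1 - y) <= _); first by nra.
by rewrite ler_wpM2l ?expR_ge1Dx//; lra.
Qed.

(** * One-step bounds drawn from the recurrence *)

Lemma sphere_count_growth (R : realType) d n :
  (2 * d * sphere_count R d n <= n.+1 * sphere_count R d n.+1)%N.
Proof.
case: n => [|n]; first by rewrite sphere_count0 sphere_count1; lia.
by rewrite sphere_count_rec leq_addr.
Qed.

(** In the recurrence, [sphere_count_growth] bounds s(n-1) by n s(n) / (2 d). Hence (n + 1) s(n+1) /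
    (2 d s(n)) is at most 1 + n^2 / (4 d^2), written here without division. *)
Lemma sphere_count_succ_le (R : realType) d n :
  (2 * d * (n.+1 * sphere_count R d n.+1) <=
   (4 * d ^ 2 + n ^ 2) * sphere_count R d n)%N.
Proof.
case: n => [|n]; first by rewrite sphere_count0 sphere_count1; lia.
have := sphere_count_growth R d n; rewrite sphere_count_rec.
set x := sphere_count R d n; set y := sphere_count R d n.+1 => xy.
have : (n * (2 * d * x) <= n * (n.+1 * y))%N by rewrite leq_mul2l xy orbT.
nia.
Qed.

(** The upper bound, fed back into the recurrence, bounds s(n-1) from below by s(n). The ratio of
    the previous lemma is thus at least 1 + n (n - 1) / (4 d^2 + n^2). *)
Lemma sphere_count_succ_ge (R : realType) d n :
  (2 * d * ((4 * d ^ 2 + n ^ 2 + n * n.-1) * sphere_count R d n) <=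
   (4 * d ^ 2 + n ^ 2) * (n.+1 * sphere_count R d n.+1))%N.
Proof.
case: n => [|n]; first by rewrite sphere_count0 sphere_count1; lia.
have := sphere_count_succ_le R d n; rewrite sphere_count_rec /=.
set x := sphere_count R d n; set y := sphere_count R d n.+1 => xy.
have : (n * (2 * d * (n.+1 * y)) <= n * ((4 * d ^ 2 + n ^ 2) * x))%N.
  by rewrite leq_mul2l xy orbT.
nia.
Qed.

Lemma sphere_count_gt0 (R : realType) d n : (0 < d)%N -> (0 < sphere_count R d n)%N.
Proof.
move=> d0; elim: n => [|n IH]; first by rewrite sphere_count0.
have := sphere_count_growth R d n.
by rewrite lt0n; apply: contraL => /eqP ->; rewrite muln0 -ltnNge !muln_gt0 d0.
Qed.

(* Consecutive sphere counts grow by a factor of at least 2 d / n >= 4. *)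
Lemma ball_count_le (R : realType) d n : (2 * n <= d)%N ->
  (ball_count R d n <= 2 * sphere_count R d n)%N.
Proof.
elim: n => [|n IH] nd; rewrite ball_count_sum.
  by rewrite big_ord1 leq_pmull.
rewrite big_ord_recr /= -ball_count_sum.
have /IH {}IH : (2 * n <= d)%N by lia.
have g := sphere_count_growth R d n.
have : (n.+1 * (4 * sphere_count R d n) <= n.+1 * sphere_count R d n.+1)%N.
  by apply: leq_trans g; rewrite mulnA leq_mul2r; apply/orP; right; lia.
by rewrite leq_mul2l /=; lia.
Qed.

Lemma sphere_count_le_ball (R : realType) d n :
  (sphere_count R d n <= ball_count R d n)%N.
Proof. by rewrite ball_count_sum big_ord_recr /= leq_addl. Qed.

(** * Comparison of the sphere counts with 2^n C(d, n) *)

(** This is the integral of t / d + 3 t^2 / (4 d^2) over [0, n], the continuous form of the sum of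
    the step exponents. *)
Definition main_exponent (R : realType) (d n : nat) : R :=
  n%:R * (n%:R / d%:R) / 2 + n%:R * (n%:R / d%:R) ^+ 2 / 4.

Definition sign_count (R : realType) (d n : nat) : R := 2 ^+ n * 'C(d, n)%:R.

Lemma sign_count_gt0 (R : realType) d n : (n <= d)%N -> 0 < sign_count R d n.
Proof. by move=> nd; rewrite mulr_gt0 ?exprn_gt0 ?ltr0n ?bin_gt0. Qed.

Lemma sign_count_succ (R : realType) d n : (0 < d)%N -> (n <= d)%N ->
  n.+1%:R * sign_count R d n.+1 =
  2 * d%:R * (1 - n%:R / d%:R) * sign_count R d n.
Proof.
move=> d0 nd; have binE : n.+1%:R * 'C(d, n.+1)%:R = (d%:R - n%:R) * 'C(d, n)%:R :> R.
  by rewrite -natrM mul_bin_left natrM natrB.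
by rewrite /sign_count mulrCA binE exprS; field; rewrite pnatr_eq0 -lt0n.
Qed.

(** Induction on [n]: with a = n / d, a step multiplies the ratio of the two counts by at most (1 +
    a^2 / 4) / (1 - a) <= exp(a + 3 a^2 / 4 + a^3), which the growth of the exponent covers. *)
Lemma sphere_count_le_expR (R : realType) d n : (0 < d)%N -> (2 * n <= d)%N ->
  (sphere_count R d n)%:R <=
  sign_count R d n * expR (main_exponent R d n + n%:R * (n%:R / d%:R) ^+ 3).
Proof.
move=> d0; elim: n => [|n IH] nd.
  by rewrite sphere_count0 /sign_count /main_exponent !mul0r !addr0 expR0 bin0 expr0 !mulr1.
have /IH {}IH : (2 * n <= d)%N by lia.
have dR : 0 < d%:R :> R by rewrite ltr0n.
set a := n%:R / d%:R : R.
have a0 : 0 <= a by rewrite divr_ge0.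
have a1 : 2 * a <= 1.
  by rewrite mulrA ler_pdivrMr// mul1r -natrM ler_nat; lia.
rewrite -(@ler_pM2l _ n.+1%:R)// mulrA sign_count_succ//; last by lia.
have step : n.+1%:R * (sphere_count R d n.+1)%:R <=
    2 * d%:R * (expR (a ^+ 2 / 4) * (sphere_count R d n)%:R).
  apply: le_trans (_ : 2 * d%:R * ((1 + a ^+ 2 / 4) * (sphere_count R d n)%:R) <= _).
    have := sphere_count_succ_le R d n.
    rewrite -(ler_nat R) !natrM natrD natrM !natrX -(ler_pM2l dR) => h.
    rewrite -(@ler_pM2l _ (2 * d%:R * d%:R)); last by nra.
    apply: le_trans (le_trans _ h) _; first by rewrite le_eqVlt; apply/orP; left; apply/eqP; ring.
    rewrite le_eqVlt; apply/orP; left; apply/eqP; rewrite /a; field.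
    by rewrite pnatr_eq0 -lt0n.
  by rewrite ler_wpM2l ?ler_wpM2r ?expR_ge1Dx// mulr_ge0.
apply: (le_trans step); rewrite -/a.
set t := sign_count R d n; set e := expR (_ + _ ).
have -> : 2 * d%:R * (1 - a) * t * e = 2 * d%:R * ((1 - a) * (t * e)) by ring.
rewrite ler_wpM2l ?mulr_ge0// {}/t {}/e.
(* Inserting a factor that is at least 1 by [inv1B_le_expR] produces the 1 - a of the right-hand
   side. *)
apply: le_trans (_ : expR (a ^+ 2 / 4) * ((1 - a) * expR (a + a ^+ 2 / 2 + a ^+ 3)
  * (sign_count R d n * expR (main_exponent R d n + n%:R * a ^+ 3))) <= _).
  rewrite ler_wpM2l ?expR_ge0// -[leLHS]mul1r ler_pM// inv1B_le_expR//.
rewrite (_ : expR _ * _ = (1 - a) * (sign_count R d n * expR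
    (a ^+ 2 / 4 + (a + a ^+ 2 / 2 + a ^+ 3)
     + (main_exponent R d n + n%:R * a ^+ 3)))); last by rewrite !expRD; ring.
rewrite ler_wpM2l//; first by lra.
rewrite ler_wpM2l ?ler_expR//; first by rewrite ltW// sign_count_gt0//; lia.
rewrite /main_exponent /a -[n.+1%:R]natr1.
have : 0 < d%:R^-1 :> R by rewrite invr_gt0.
have : 0 <= n%:R :> R by [].
move: (n%:R : R) (d%:R^-1 : R) => m b m0 b0.
(* With [m] = n and [b] = 1 / d, the surplus is a polynomial with nonnegative coefficients. *)
rewrite -subr_ge0; set D := (X in 0 <= X).
have -> : D = b / 2 + (3 * m + 1) * b ^+ 2 / 4
    + (3 * m ^+ 3 + 6 * m ^+ 2 + 4 * m + 1) * b ^+ 3 by rewrite /D; field.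
by rewrite !(addr_ge0, mulr_ge0, exprn_ge0)// ltW.
Qed.

(** The same induction, with step factor at least exp(a + 3 a^2 / 4 - a^3 - 1 / d). The term 3 n / d
    pays for the 1 / d lost at each step and for the excess of the increment of [main_exponent] over
    a + 3 a^2 / 4. *)
Lemma sphere_count_ge_expR (R : realType) d n : (0 < d)%N -> (2 * n <= d)%N ->
  sign_count R d n *
    expR (main_exponent R d n - n%:R * (n%:R / d%:R) ^+ 3 - 3 * (n%:R / d%:R))
  <= (sphere_count R d n)%:R.
Proof.
move=> d0; elim: n => [|n IH] nd.
  by rewrite sphere_count0 /sign_count /main_exponent !mul0r !addr0 mulr0 !subr0 expR0 bin0 expr0 !mulr1.
have /IH {}IH : (2 * n <= d)%N by lia.
have dR : 0 < d%:R :> R by rewrite ltr0n.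
have nR : 0 <= n%:R :> R by [].
have ndR : 2 * n%:R <= d%:R :> R by rewrite -natrM ler_nat; lia.
set a := n%:R / d%:R : R.
have a0 : 0 <= a by rewrite divr_ge0.
have a1 : 2 * a <= 1.
  by rewrite mulrA ler_pdivrMr// mul1r.
pose b := d%:R^-1 : R.
have b0 : 0 < b by rewrite invr_gt0.
rewrite -(@ler_pM2l _ n.+1%:R)// [leLHS]mulrA sign_count_succ//; last by lia.
have step : 2 * d%:R * (expR (a ^+ 2 / 4 - a ^+ 3 - b) * (sphere_count R d n)%:R) <=
  n.+1%:R * (sphere_count R d n.+1)%:R.
  (* The excess over 1 in [sphere_count_succ_ge]; it equals (a^2 - a b) / (4 + a^2), where [a * b]
     comes from n (n - 1) replacing n^2. *)
  pose x : R := (n * n.-1)%:R / (4 * d%:R ^+ 2 + n%:R ^+ 2).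
  have q0 : 0 < 4 * d%:R ^+ 2 + n%:R ^+ 2 :> R by nra.
  apply: le_trans (_ : 2 * d%:R * ((1 + x) * (sphere_count R d n)%:R) <= _); last first.
    have := sphere_count_succ_ge R d n.
    rewrite -(ler_nat R) !(natrM, natrD, natrX) => h.
    rewrite -(ler_pM2l q0); apply: le_trans h.
    rewrite le_eqVlt; apply/orP; left; apply/eqP; rewrite /x natrM; field.
    by rewrite gt_eqF.
  rewrite ler_wpM2l ?ler_wpM2r// ?mulr_ge0// expR_le1D ?divr_ge0 ?(ltW q0)//.
  have xE : x * (4 + a ^+ 2) = a ^+ 2 - a * b.
    (* The truncated predecessor [n.-1] makes n = 0 a separate case. *)
    case: n @a @x {IH nd nR ndR a0 a1} q0 => [|n] a x q0.
      by rewrite /x /a !mul0r; ring.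
    rewrite /x /a /b /= natrM -[n.+1%:R]natr1 -natr1; field.
    by rewrite natr1 !gt_eqF.
  have x0 : 0 <= x by rewrite divr_ge0 ?(ltW q0).
  (* A nonpositive exponent is immediate since [x] is nonnegative; otherwise its sign allows (1 + x)
     (4 + a^2) to be enlarged to 4 + 2 a^2. *)
  have [y0|/ltW y0] := leP (a ^+ 2 / 4 - a ^+ 3 - b) 0.
    by apply: (le_trans _ x0); rewrite mulr_le0_ge0 ?addr_ge0.
  have q1 : 0 < 4 + a ^+ 2 by nra.
  rewrite -(ler_pM2r q1) -[leLHS]mulrA [(1 + x) * _]mulrDl mul1r xE.
  set y := a ^+ 2 / 4 - a ^+ 3 - b in y0 *.
  have ab : 0 <= a * b by rewrite mulr_ge0// ltW.
  apply: le_trans (_ : y * (4 + 2 * a ^+ 2) <= _).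
    by rewrite ler_wpM2l//; lra.
  rewrite -subr_ge0; set D := (X in 0 <= X).
  have -> : D = a ^+ 3 * (4 - a / 2) + (4 - a) * b + 2 * a ^+ 5 + 2 * a ^+ 2 * b.
    by rewrite /D /y; field.
  rewrite !addr_ge0// ?mulr_ge0 ?exprn_ge0 ?(ltW b0)//; lra.
apply: le_trans step; rewrite -/a.
set t := sign_count R d n in IH *; set e := expR (_ - _).
have -> : 2 * d%:R * (1 - a) * t * e = 2 * d%:R * ((1 - a) * (t * e)) by ring.
rewrite ler_wpM2l ?mulr_ge0// {}/e.
have t0 : 0 <= t by rewrite ltW// sign_count_gt0//; lia.
set u := _ - _ in IH.
apply: le_trans (_ : expR (a ^+ 2 / 4 - a ^+ 3 - b) *
    ((1 - a) * expR (a + a ^+ 2 / 2) * (t * expR u)) <= _); last first.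
  rewrite ler_wpM2l ?expR_ge0//; apply: le_trans IH.
  by rewrite ler_piMl ?mulr_ge0 ?expR_ge0// expR_le_inv1B//; lra.
rewrite (_ : expR _ * _ = (1 - a) * (t * expR
    (a ^+ 2 / 4 - a ^+ 3 - b + (a + a ^+ 2 / 2) + u))); last first.
  by rewrite !expRD; ring.
rewrite ler_wpM2l//; first by lra.
rewrite ler_wpM2l ?ler_expR//.
have : n%:R * b + b <= 1.
  by rewrite /b -[X in _ + X]mul1r -mulrDl natr1 ler_pdivrMr// mul1r ler_nat; lia.
rewrite /u /main_exponent /a -[n.+1%:R]natr1 -/b.
move: (n%:R : R) nR b b0 => m m0 b b0 mb.
rewrite -subr_ge0; set D := (X in 0 <= X).
have -> : D = b * (1 - m * b) * (3 / 4) + b * (3 / 4 - b / 4)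
    + (3 * m ^+ 3 + 6 * m ^+ 2 + 4 * m + 1) * b ^+ 3 by rewrite /D; field.
have mb0 : 0 <= m * b by rewrite mulr_ge0// ltW.
have h1 : 0 <= 1 - m * b by lra.
have h2 : 0 <= 3 / 4 - b / 4 by lra.
by rewrite !(h1, h2, addr_ge0, mulr_ge0, exprn_ge0)// ltW.
Qed.

(** * Assembly of the estimates *)

Lemma approx_ball_sphere (R : realType) (P : nat -> nat -> Prop) :
  (forall d n, P d n -> half_range d n) ->
  approx_on P (fun d n => (ball_count R d n)%:R : R)
    (fun d n => (sphere_count R d n)%:R).
Proof.
move=> Phalf; exists 2 => // d n /Phalf[_ _ nd].
rewrite -!natrM !ler_nat ball_count_le//.
by rewrite (leq_trans (sphere_count_le_ball R d n))// leq_pmull.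
Qed.

Lemma half_range_ratio (R : realType) d n : half_range d n ->
  0 <= n%:R / d%:R :> R /\ 2 * (n%:R / d%:R) <= 1 :> R.
Proof.
move=> [d0 _ nd]; split; first by rewrite divr_ge0.
by rewrite mulrA ler_pdivrMr ?ltr0n// mul1r -natrM ler_nat.
Qed.

Theorem corollary1p8 (R : realType) :
  (approx_on half_range
     (fun d n => (ball_count R d n)%:R : R)
     (fun d n => (sphere_count R d n)%:R)
   /\
   exists2 E : nat -> nat -> R,
     bigO_on half_range E (fun d n => n%:R * (n%:R / d%:R) ^+ 3) &
     approx_on half_range
       (fun d n => (sphere_count R d n)%:R)
       (fun d n =>
          let alpha : R := n%:R / d%:R in
          2 ^+ n * ('C(d, n))%:R *
          expR (n%:R * alpha / 2 + n%:R * alpha ^+ 2 / 4 + E d n)))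
  /\
  (forall A : R, 0 < A ->
     [/\ approx_on (sqrt_range A)
           (fun d n => (ball_count R d n)%:R : R)
           (fun d n => (sphere_count R d n)%:R),
         approx_on (sqrt_range A)
           (fun d n => (sphere_count R d n)%:R : R)
           (fun d n => 2 ^+ n * ('C(d, n))%:R) &
         forall d n : nat, sqrt_range A d n ->
           (2 ^ n * 'C(d, n))%N
           = setcard (l1sphere R d n `&` sign_vectors R d)]).
Proof.
split; [split; first exact: approx_ball_sphere|move=> A A0; split].
- pose K d n : R := n%:R * (n%:R / d%:R) ^+ 3.
  (* [L] is the exact error in the exponent, [K] its target size. *)
  pose L d n : R :=
    ln ((sphere_count R d n)%:R / sign_count R d n) - main_exponent R d n.
  have sphereE d n : half_range d n ->
      (sphere_count R d n)%:R
      = sign_count R d n * expR (main_exponent R d n + L d n).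
    move=> [d0 _ nd]; have T0 : 0 < sign_count R d n.
      by apply: sign_count_gt0; lia.
    rewrite /L addrC subrK lnK ?posrE ?divr_gt0 ?ltr0n ?sphere_count_gt0//.
    by rewrite mulrC divfK// gt_eqF.
  (* Here 3 / 2 bounds 3 n / d. [L] itself is not O(K): for n = 1 it is -1 / (2 d) - 1 / (4 d^2),
     while [K] is 1 / d^3. *)
  have LK d n : half_range d n -> - K d n - 3 / 2 <= L d n <= K d n.
    move=> h; have [d0 _ nd] := h; have [_ a1] := half_range_ratio R h.
    have T0 : 0 < sign_count R d n by apply: sign_count_gt0; lia.
    have := sphere_count_ge_expR R d0 nd; have := sphere_count_le_expR R d0 nd.
    rewrite sphereE// !(ler_pM2l T0) !ler_expR -/(K d n) => hi lo.
    by apply/andP; split; lra.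
  have K0 d n : 0 <= K d n by rewrite mulr_ge0 ?exprn_ge0 ?divr_ge0.
  (* Truncating L below at - K changes it by at most 3 / 2. *)
  exists (fun d n => Num.max (L d n) (- K d n)).
    exists 1 => // d n /LK /andP[_ hi]; rewrite mul1r -/(K d n) ler_norml.
    by rewrite le_max lexx orbT ge_max hi /= lerNl (le_trans _ (K0 d n))// oppr_le0.
  exists (expR (3 / 2)); first exact: expR_gt0.
  move=> d n h; have [d0 _ nd] := h; have /andP[lo hi] := LK d n h.
  have T0 : 0 <= sign_count R d n by rewrite ltW// sign_count_gt0//; lia.
  rewrite /= -/(main_exponent R d n) -/(sign_count R d n) sphereE//.
  rewrite ![expR (3 / 2) * _]mulrCA -!expRD !ler_wpM2l ?ler_expR//.
  + by rewrite addrCA lerD2l ge_max; apply/andP; split; lra.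
  + have : L d n <= Num.max (L d n) (- K d n) by rewrite le_max lexx.
    by move: (Num.max _ _) => m; lra.
- by apply: approx_ball_sphere => d n [].
(* With q = n a <= A^2 and a <= 1 / 2, the upper exponent is at most 7 q / 8 and the lower one at
   least - q / 4 - 3 / 2. *)
- exists (expR (2 * A ^+ 2 + 3 / 2)); first exact: expR_gt0.
  move=> d n [h nA]; have [d0 _ nd] := h; have [a0 a1] := half_range_ratio R h.
  rewrite -/(sign_count R d n).
  have T0 : 0 <= sign_count R d n by rewrite ltW// sign_count_gt0//; lia.
  have na : n%:R * (n%:R / d%:R) <= A ^+ 2 :> R.
    rewrite mulrA ler_pdivrMr ?ltr0n// -expr2 -[X in _ <= _ * X]sqr_sqrtr//.
    by rewrite -exprMn ler_pXn2r ?nnegrE ?mulr_ge0 ?sqrtr_ge0 ?(ltW A0).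
  have := sphere_count_ge_expR R d0 nd; have := sphere_count_le_expR R d0 nd.
  set a := n%:R / d%:R in a0 a1 na *; set q := n%:R * a in na *.
  have -> : main_exponent R d n = q / 2 + q * a / 4.
    by rewrite /main_exponent -/a /q expr2 mulrA.
  have -> : n%:R * a ^+ 3 = q * a * a by rewrite /q; ring.
  have q0 : 0 <= q by rewrite mulr_ge0.
  have qa : 0 <= q * a by rewrite mulr_ge0.
  have qa1 : 2 * (q * a) <= q by rewrite mulrCA ler_piMr.
  have qaa : 2 * (q * a * a) <= q * a by rewrite mulrCA ler_piMr.
  have qaa0 : 0 <= q * a * a by rewrite mulr_ge0.
  have A2 : 0 <= A ^+ 2 by exact: sqr_ge0.
  move=> hi lo; split.
    by apply: (le_trans hi); rewrite [leRHS]mulrC ler_wpM2l// ler_expR; lra.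
  rewrite -ler_pdivrMl ?expR_gt0// -expRN mulrC; apply: le_trans lo.
  by rewrite ler_wpM2l// ler_expR; lra.
- by move=> d n _; rewrite sign_countE.
Qed.
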